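(* Let $\mathcal{C}$ be a monoidal category and $(P,Q)$ a pivotal pair in $\mathcal{C}$. If $\mathcal{C}$ is left rigid (respectively right rigid), then the monoidal category $\mathcal{C}(P,Q)$ is left rigid (respectively right rigid).
   Context: Monoidal categories $(\mathcal{C},\otimes,\mathbf 1)$ are assumed strict; object names also denote identity morphisms. A left dual of $X$ is an object ${}^{\vee}X$ with $\mathrm{ev}_X:{}^{\vee}X\otimes X\to\mathbf 1$, $\mathrm{coev}_X:\mathbf 1\to X\otimes{}^{\vee}X$ satisfying the two triangle identities; $Y$ is a right dual of $X$ if $X$ is a left dual of $Y$. A monoidal category is left (right) rigid if every object has a left (right) dual. A pivotal pair $(P,Q)$ in $\mathcal{C}$ consists of objects $P,Q$ with morphisms $\mathrm{coev}:\mathbf 1\to P\otimes Q$, $\mathrm{ev}:Q\otimes P\to\mathbf 1$ making $Q$ a left dual of $P$, i.e. $(\mathrm{ev}\otimes Q)(Q\otimes\mathrm{coev})=\mathrm{id}_Q$, $(P\otimes\mathrm{ev})(\mathrm{coev}\otimes P)=\mathrm{id}_P$, and morphisms $\underline{\mathrm{coev}}:\mathbf 1\to Q\otimes P$, $\underline{\mathrm{ev}}:P\otimes Q\to\mathbf 1$ making $Q$ a right dual of $P$, i.e. $(\underline{\mathrm{ev}}\otimes P)(P\otimes\underline{\mathrm{coev}})=\mathrm{id}_P$, $(Q\otimes\underline{\mathrm{ev}})(\underline{\mathrm{coev}}\otimes Q)=\mathrm{id}_Q$. The category $\mathcal{C}(P,Q)$: objects are pairs $(X,\sigma)$ with $X$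 an object of $\mathcal{C}$ and $\sigma:X\otimes P\to P\otimes X$ an invertible morphism such that the two morphisms $$(\mathrm{ev}\otimes X\otimes Q)(Q\otimes\sigma\otimes Q)(Q\otimes X\otimes\mathrm{coev}):Q\otimes X\to X\otimes Q,$$ $$(Q\otimes X\otimes\underline{\mathrm{ev}})(Q\otimes\sigma^{-1}\otimes Q)(\underline{\mathrm{coev}}\otimes X\otimes Q):X\otimes Q\to Q\otimes X$$ are inverse to each other. Morphisms $(X,\sigma)\to(Y,\tau)$ are morphisms $f:X\to Y$ in $\mathcal{C}$ with $\tau(f\otimes P)=(P\otimes f)\sigma$. It is monoidal via $(X,\sigma)\otimes(Y,\tau)=(X\otimes Y,(\sigma\otimes Y)(X\otimes\tau))$ with unit $(\mathbf 1,\mathrm{id}_P)$. *)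

(* Defs.v *)
From Stdlib Require Import ProofIrrelevance.
From mathcomp Require Import all_boot.

Set Implicit Arguments.
Unset Strict Implicit.
Unset Printing Implicit Defensive.

Declare Scope cat_scope.
Delimit Scope cat_scope with cat.
Local Open Scope cat_scope.

Reserved Notation "X ⊗ Y" (at level 40, left associativity).
Reserved Notation "f ⊠ g" (at level 40, left associativity).
Reserved Notation "g ∘ f" (at level 50, left associativity).
Reserved Notation "g ⊚ f" (at level 50, left associativity).
Reserved Notation "f === g" (at level 70, no associativity).

Record category := Category {
  ob :> Type;
  hom : ob -> ob -> Type;
  idm : forall X, hom X X;
  comp : forall X Y Z, hom Y Z -> hom X Y -> hom X Z;
  compA : forall X Y Z T (h : hom Z T) (g : hom Y Z) (f : hom X Y),
    comp h (comp g f) = comp (comp h g) f;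
  comp1m : forall X Y (f : hom X Y), comp (idm Y) f = f;
  compm1 : forall X Y (f : hom X Y), comp f (idm X) = f
}.
Arguments hom {c}.
Arguments idm {c}.
Notation "g ∘ f" := (comp g f) : cat_scope.

(* Strictness equates morphisms whose hom-types are only propositionally equal,
   so such equations are stated between arrows bundled with their endpoints. *)
Record arrow (C : category) := Arrow { dom : C; cod : C; mor : hom dom cod }.
Definition arr (C : category) (X Y : C) (f : hom X Y) : arrow C := Arrow f.
Notation "f === g" := (arr f = arr g) : cat_scope.

Record strict_monoidal := StrictMonoidal {
  scat :> category;
  one : scat;
  tens : scat -> scat -> scat;
  tenm : forall (X Y X' Y' : scat),
    hom X Y -> hom X' Y' -> hom (tens X X') (tens Y Y');
  tenm_id : forall X Y, tenm (idm X) (idm Y) = idm (tens X Y);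
  tenm_comp : forall (X Y Z X' Y' Z' : scat) (g : hom Y Z) (f : hom X Y)
    (g' : hom Y' Z') (f' : hom X' Y'),
    tenm (g ∘ f) (g' ∘ f') = tenm g g' ∘ tenm f f';
  tensA : forall X Y Z, tens X (tens Y Z) = tens (tens X Y) Z;
  tens1o : forall X, tens one X = X;
  tenso1 : forall X, tens X one = X;
  tenmA : forall (X Y X' Y' X'' Y'' : scat)
    (f : hom X Y) (g : hom X' Y') (h : hom X'' Y''),
    tenm f (tenm g h) === tenm (tenm f g) h;
  tenm1m : forall (X Y : scat) (f : hom X Y), tenm (idm one) f === f;
  tenmm1 : forall (X Y : scat) (f : hom X Y), tenm f (idm one) === f
}.
Arguments one {s}.
Notation "X ⊗ Y" := (tens X Y) : cat_scope.
Notation "f ⊠ g" := (tenm f g) : cat_scope.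

(* [g ⊚ f] composes morphisms whose middle objects agree up to strictness, and
   [cast f] rewrites the endpoints of [f]; the object equalities are found by
   instance search. *)
Class obj_eq (C : category) (X Y : C) : Prop := obj_eqP : X = Y.
Ltac strictness := rewrite /obj_eq ?(tens1o, tenso1, tensA); reflexivity.
#[export] Hint Extern 0 (obj_eq _ _) => strictness : typeclass_instances.

Definition cast (C : category) (X X' Y Y' : C)
    {eX : obj_eq X X'} {eY : obj_eq Y Y'} (f : hom X Y) : hom X' Y' :=
  let: erefl := eX in let: erefl := eY in f.

Definition hcomp (C : category) (X Y Y' Z : C) (g : hom Y' Z)
    {e : obj_eq Y Y'} (f : hom X Y) : hom X Z :=
  g ∘ cast (eX := erefl) (eY := e) f.
Notation "g ⊚ f" := (hcomp g f) : cat_scope.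

Definition mutual_inverse (C : category) (X Y : C)
    (f : hom X Y) (g : hom Y X) : Prop :=
  g ∘ f = idm X /\ f ∘ g = idm Y.

Definition is_left_dual (C : strict_monoidal) (X Y : C)
    (ev : hom (Y ⊗ X) one) (coev : hom one (X ⊗ Y)) : Prop :=
  (ev ⊠ idm Y) ⊚ (idm Y ⊠ coev) === idm Y /\
  (idm X ⊠ ev) ⊚ (coev ⊠ idm X) === idm X.

Definition left_dual (C : strict_monoidal) (X Y : C) : Prop :=
  exists (ev : hom (Y ⊗ X) one) (coev : hom one (X ⊗ Y)), is_left_dual ev coev.

Definition right_dual (C : strict_monoidal) (X Y : C) : Prop := left_dual Y X.

Definition left_rigid (C : strict_monoidal) : Prop :=
  forall X : C, exists Y : C, left_dual X Y.

Definition right_rigid (C : strict_monoidal) : Prop :=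
  forall X : C, exists Y : C, right_dual X Y.

Record pivotal_pair (C : strict_monoidal) := PivotalPair {
  pp : C;
  pq : C;
  pev : hom (pq ⊗ pp) one;
  pcoev : hom one (pp ⊗ pq);
  pev_r : hom (pp ⊗ pq) one;
  pcoev_r : hom one (pq ⊗ pp);
  pdual : is_left_dual pev pcoev;
  pdual_r : is_left_dual pev_r pcoev_r
}.

Definition mate (C : strict_monoidal) (V : pivotal_pair C) (X : C)
    (s : hom (X ⊗ pp V) (pp V ⊗ X)) : hom (pq V ⊗ X) (X ⊗ pq V) :=
  let Q := pq V in
  cast ((pev V ⊠ idm X ⊠ idm Q) ⊚ (idm Q ⊠ s ⊠ idm Q)
          ⊚ (idm Q ⊠ idm X ⊠ pcoev V)).

Definition comate (C : strict_monoidal) (V : pivotal_pair C) (X : C)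
    (s' : hom (pp V ⊗ X) (X ⊗ pp V)) : hom (X ⊗ pq V) (pq V ⊗ X) :=
  let Q := pq V in
  cast ((idm Q ⊠ idm X ⊠ pev_r V) ⊚ (idm Q ⊠ s' ⊠ idm Q)
          ⊚ (pcoev_r V ⊠ idm X ⊠ idm Q)).

(* [s'] is determined by [s], so it is only required to exist. *)
Definition braidP (C : strict_monoidal) (V : pivotal_pair C) (X : C)
    (s : hom (X ⊗ pp V) (pp V ⊗ X)) : Prop :=
  exists s' : hom (pp V ⊗ X) (X ⊗ pp V),
    mutual_inverse s s' /\ mutual_inverse (mate s) (comate s').

Record cpq_ob (C : strict_monoidal) (V : pivotal_pair C) := CpqOb {
  cpo : C;
  cpb : hom (cpo ⊗ pp V) (pp V ⊗ cpo);
  cpbP : braidP cpb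
}.

Record cpq_hom (C : strict_monoidal) (V : pivotal_pair C)
    (A B : cpq_ob V) := CpqHom {
  cpf : hom (cpo A) (cpo B);
  cpfP : cpb B ∘ (cpf ⊠ idm (pp V)) = (idm (pp V) ⊠ cpf) ∘ cpb A
}.

Section Arrows.
Context {C : category}.
Implicit Types X Y Z T : C.

Lemma arr_inj X Y (f g : hom X Y) : f === g -> f = g.
Proof.
move=> E; have eX : X = X := f_equal (@dom C) E.
suff H (u v : arrow C) (e : u = v) (e1 : dom v = dom u) (e2 : cod v = cod u) :
  mor u = cast (eX := e1) (eY := e2) (mor v).
  have := H _ _ E erefl erefl; exact.
case: _ / e in e1 e2 *.
by rewrite (proof_irrelevance _ e1 erefl) (proof_irrelevance _ e2 erefl).
Qed.

Lemma cast_id X Y (eX : obj_eq X X) (eY : obj_eq Y Y) (f : hom X Y) :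
  cast f = f.
Proof.
by rewrite (proof_irrelevance _ eX erefl) (proof_irrelevance _ eY erefl).
Qed.

Lemma arr_cast X X' Y Y' (eX : obj_eq X X') (eY : obj_eq Y Y') (f : hom X Y) :
  cast f === f.
Proof. by rewrite /obj_eq in eX eY *; case: _ / eX; case: _ / eY. Qed.

Lemma hcompE X Y Z (e : obj_eq Y Y) (g : hom Y Z) (f : hom X Y) :
  g ⊚ f = g ∘ f.
Proof. by rewrite /hcomp cast_id. Qed.

Lemma arr_hcomp X Y Y' Z (e : obj_eq Y Y') (g : hom Y' Z) (f : hom X Y)
    U V V' W (e' : obj_eq V V') (g' : hom V' W) (f' : hom U V) :
  g === g' -> f === f' -> g ⊚ f === g' ⊚ f'.
Proof.
suff H (u u' v v' : arrow C) (h : obj_eq (cod u) (dom v))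
    (h' : obj_eq (cod u') (dom v')) : v = v' -> u = u' ->
  hcomp (e := h) (mor v) (mor u) === hcomp (e := h') (mor v') (mor u').
  by move=> Eg Ef; apply: (H (arr f) (arr f') (arr g) (arr g') e e' Eg Ef).
move=> Ev Eu; case: _ / Ev in h' *; case: _ / Eu in h' *.
by rewrite (proof_irrelevance _ h h').
Qed.

Lemma arr_comp X Y Z (g : hom Y Z) (f : hom X Y)
    U V W (g' : hom V W) (f' : hom U V) :
  g === g' -> f === f' -> g ∘ f === g' ∘ f'.
Proof. by move=> Eg Ef; apply: (@arr_hcomp X Y Y Z erefl g f U V V W erefl g' f'). Qed.

End Arrows.

Section Words.
Context {C : strict_monoidal}.
Implicit Types (X Y Z : C) (a b c d l r m : seq C).

Definition atens (u v : arrow C) : arrow C := arr (mor u ⊠ mor v).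

Lemma atensE X Y X' Y' (f : hom X Y) (g : hom X' Y') :
  arr (f ⊠ g) = atens (arr f) (arr g).
Proof. by []. Qed.

Lemma atensA u v w : atens u (atens v w) = atens (atens u v) w.
Proof. exact: tenmA. Qed.

Lemma atens1a u : atens (arr (idm one)) u = u.
Proof. by case: u => X Y f; exact: tenm1m. Qed.

Lemma atensa1 u : atens u (arr (idm one)) = u.
Proof. by case: u => X Y f; exact: tenmm1. Qed.

Lemma arr_idm_tens X Y : arr (idm (X ⊗ Y)) = atens (arr (idm X)) (arr (idm Y)).
Proof. by rewrite -atensE tenm_id. Qed.

(* The object named by a word.  Since [cat] computes, tensoring words is
   associative up to conversion whenever their shapes are explicit. *)
Fixpoint word l : C :=
  if l is X :: l' then (if l' is [::] then X else X ⊗ word l') else one.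

Lemma word_cons X l : X ⊗ word l = word (X :: l).
Proof. by case: l => //=; rewrite tenso1. Qed.

Lemma word_cat l r : word l ⊗ word r = word (l ++ r).
Proof.
elim: l => [|X l IHl]; first by rewrite tens1o.
by rewrite cat_cons -!word_cons -tensA IHl.
Qed.

Lemma arr_word_cons X l :
  arr (idm (word (X :: l))) = atens (arr (idm X)) (arr (idm (word l))).
Proof. by rewrite -word_cons arr_idm_tens. Qed.

Lemma whisker_eq l a r : word l ⊗ word a ⊗ word r = word (l ++ (a ++ r)).
Proof. by rewrite catA -!word_cat. Qed.

Definition whisker l a b (f : hom (word a) (word b)) r :
    hom (word (l ++ (a ++ r))) (word (l ++ (b ++ r))) :=
  cast (eX := whisker_eq l a r) (eY := whisker_eq l b r)
    (idm (word l) ⊠ f ⊠ idm (word r)).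
Arguments whisker : clear implicits.

Lemma arr_whisker l a b (f : hom (word a) (word b)) r :
  arr (whisker l a b f r) =
  atens (atens (arr (idm (word l))) (arr f)) (arr (idm (word r))).
Proof. exact: arr_cast. Qed.

Lemma arr_word_cat l r :
  arr (idm (word (l ++ r))) = atens (arr (idm (word l))) (arr (idm (word r))).
Proof. by rewrite -word_cat arr_idm_tens. Qed.

Lemma whisker_id l a r : whisker l a a (idm _) r = idm _.
Proof. by apply: arr_inj; rewrite arr_whisker !arr_word_cat atensA. Qed.

Lemma whisker_comp l a b c (g : hom (word b) (word c))
    (f : hom (word a) (word b)) r :
  whisker l a c (g ∘ f) r = whisker l b c g r ∘ whisker l a b f r.
Proof.
have E : idm (word l) ⊠ (g ∘ f) ⊠ idm (word r) =
    (idm (word l) ⊠ g ⊠ idm (word r)) ∘ (idm (word l) ⊠ f ⊠ idm (word r)).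
  by rewrite -!tenm_comp !comp1m.
apply: arr_inj; rewrite arr_whisker; apply: etrans (f_equal (@arr _ _ _) E) _.
by apply: arr_comp; exact/esym/arr_cast.
Qed.

Lemma whisker_whisker l' l a b (f : hom (word a) (word b)) r r'
    (eX : obj_eq _ _) (eY : obj_eq _ _) :
  whisker l' _ _ (whisker l a b f r) r' =
  cast (eX := eX) (eY := eY) (whisker (l' ++ l) a b f (r ++ r')).
Proof.
apply: arr_inj.
by rewrite arr_cast !arr_whisker !arr_word_cat !atensA.
Qed.

Lemma whisker_swap l a b (f : hom (word a) (word b)) m
    c d (g : hom (word c) (word d)) r
    (e1 e2 e3 e4 : obj_eq _ _) :
  cast (eX := e1) (eY := e2) (whisker (l ++ (b ++ m)) c d g r) ∘
    whisker l a b f (m ++ (c ++ r)) =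
  whisker l a b f (m ++ (d ++ r)) ∘
    cast (eX := e3) (eY := e4) (whisker (l ++ (a ++ m)) c d g r).
Proof.
have E : (idm (word l) ⊠ idm (word b) ⊠ idm (word m) ⊠ g ⊠ idm (word r)) ∘
     (idm (word l) ⊠ f ⊠ idm (word m) ⊠ idm (word c) ⊠ idm (word r)) =
   (idm (word l) ⊠ f ⊠ idm (word m) ⊠ idm (word d) ⊠ idm (word r)) ∘
     (idm (word l) ⊠ idm (word a) ⊠ idm (word m) ⊠ g ⊠ idm (word r)).
  by rewrite -!tenm_comp !comp1m !compm1.
apply: arr_inj; apply: etrans (etrans (f_equal (@arr _ _ _) E) _).
all: apply: arr_comp; rewrite ?arr_cast ?arr_whisker ?atensE.
all: by rewrite ?arr_word_cat ?atensA.
Qed.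

End Words.
Arguments whisker {C} l a b f r.

(* Unification does not invert [cat], hence the explicit arguments. *)
Ltac expand_whiskers :=
  repeat match goal with |- context [whisker ?l ?a ?b ?f ?r] =>
    rewrite (@arr_whisker _ l a b f r)
  end.

Lemma comp_eql (C : category) (X Y Z : C) (g : hom Y Z) (f : hom X Y)
    (h : hom X Z) :
  g ∘ f = h -> forall T (k : hom T X), g ∘ (f ∘ k) = h ∘ k.
Proof. by move=> E T k; rewrite compA E. Qed.

Ltac normalize_whiskers :=
  repeat match goal with
  | |- context [whisker ?l ?a ?c (?g ∘ whisker ?l' ?a' ?b' ?f ?r') ?r] =>
    rewrite (@whisker_comp _ l a (l' ++ (b' ++ r')) c g (whisker l' a' b' f r') r)
  | |- context [whisker ?l' _ _ (whisker ?l ?a ?b ?f ?r) ?r'] =>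
    rewrite (@whisker_whisker _ l' l a b f r r' erefl erefl)
  end; rewrite /= -?compA.

Ltac rewrite_comp E :=
  first [rewrite (comp_eql E) | rewrite E]; rewrite /= -?compA ?comp1m.

(* [f] acts to the left of [g]; the first tactic lets [g] act before [f], the
   second one [f] before [g]. *)
Ltac slide_l l a b f m c d g r :=
  let E := fresh in
  pose proof (E := @whisker_swap _ l a b f m c d g r erefl erefl erefl erefl);
  rewrite /= in E; rewrite_comp E; clear E.
Ltac slide_r l a b f m c d g r :=
  let E := fresh in
  pose proof (E := esym
    (@whisker_swap _ l a b f m c d g r erefl erefl erefl erefl));
  rewrite /= in E; rewrite_comp E; clear E.

Section Cpq.
Context {C : strict_monoidal} (V : pivotal_pair C).
Implicit Types X Y Z : C.
Local Notation P := (pp V).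
Local Notation Q := (pq V).
Local Notation W := whisker.

Lemma zigzag_p : W [:: P] [:: Q; P] [::] (pev V) [::] ∘
  W [::] [::] [:: P; Q] (pcoev V) [:: P] = idm (word [:: P]).
Proof.
apply: arr_inj; rewrite -(proj2 (pdual V)) -(@hcompE _ _ _ _ erefl).
by apply: arr_hcomp; expand_whiskers; rewrite /= ?(atensa1, atens1a).
Qed.

Lemma zigzag_q : W [::] [:: Q; P] [::] (pev V) [:: Q] ∘
  W [:: Q] [::] [:: P; Q] (pcoev V) [::] = idm (word [:: Q]).
Proof.
apply: arr_inj; rewrite -(proj1 (pdual V)) -(@hcompE _ _ _ _ erefl).
by apply: arr_hcomp; expand_whiskers; rewrite /= ?(atensa1, atens1a).
Qed.

Lemma zigzag_r_p : W [::] [:: P; Q] [::] (pev_r V) [:: P] ∘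
  W [:: P] [::] [:: Q; P] (pcoev_r V) [::] = idm (word [:: P]).
Proof.
apply: arr_inj; rewrite -(proj1 (pdual_r V)) -(@hcompE _ _ _ _ erefl).
by apply: arr_hcomp; expand_whiskers; rewrite /= ?(atensa1, atens1a).
Qed.

Lemma zigzag_r_q : W [:: Q] [:: P; Q] [::] (pev_r V) [::] ∘
  W [::] [::] [:: Q; P] (pcoev_r V) [:: Q] = idm (word [:: Q]).
Proof.
apply: arr_inj; rewrite -(proj2 (pdual_r V)) -(@hcompE _ _ _ _ erefl).
by apply: arr_hcomp; expand_whiskers; rewrite /= ?(atensa1, atens1a).
Qed.

Lemma mateE (x : seq C) (s : hom (word x ⊗ P) (P ⊗ word x))
    (s' : hom (word (x ++ [:: P])) (word (P :: x))) (e1 e2 : obj_eq _ _) :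
  s === s' ->
  mate s === hcomp (e := e1)
    (hcomp (e := e2) (W [::] [:: Q; P] [::] (pev V) (x ++ [:: Q]))
       (W [:: Q] (x ++ [:: P]) (P :: x) s' [:: Q]))
    (W (Q :: x) [::] [:: P; Q] (pcoev V) [::]).
Proof.
move=> Es; rewrite /mate arr_cast; apply: arr_hcomp; first apply: arr_hcomp.
all: expand_whiskers.
- by rewrite arr_word_cat atens1a !atensE atensA.
- by rewrite !atensE Es.
by rewrite arr_word_cons atensa1 !atensE.
Qed.

Lemma comateE (x : seq C) (s : hom (P ⊗ word x) (word x ⊗ P))
    (s' : hom (word (P :: x)) (word (x ++ [:: P]))) (e1 e2 : obj_eq _ _) :
  s === s' ->
  comate s === hcomp (e := e1)
    (hcomp (e := e2) (W (Q :: x) [:: P; Q] [::] (pev_r V) [::])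
       (W [:: Q] (P :: x) (x ++ [:: P]) s' [:: Q]))
    (W [::] [::] [:: Q; P] (pcoev_r V) (x ++ [:: Q])).
Proof.
move=> Es; rewrite /comate arr_cast; apply: arr_hcomp; first apply: arr_hcomp.
all: expand_whiskers.
- by rewrite arr_word_cons atensa1 !atensE.
- by rewrite !atensE Es.
by rewrite arr_word_cat atens1a !atensE atensA.
Qed.

Definition braid_tens X Y (s : hom (X ⊗ P) (P ⊗ X)) (t : hom (Y ⊗ P) (P ⊗ Y)) :
    hom (X ⊗ Y ⊗ P) (P ⊗ (X ⊗ Y)) :=
  cast ((s ⊠ idm Y) ⊚ (idm X ⊠ t)).

Definition braid_one : hom (one ⊗ P) (P ⊗ one) := cast (idm P).
Definition braid_one' : hom (P ⊗ one) (one ⊗ P) := cast (idm P).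

Lemma braid_tensE X Y (s : hom (X ⊗ P) (P ⊗ X)) (t : hom (Y ⊗ P) (P ⊗ Y)) :
  braid_tens s t ===
  W [::] [:: X; P] [:: P; X] s [:: Y] ∘ W [:: X] [:: Y; P] [:: P; Y] t [::].
Proof.
rewrite arr_cast -(@hcompE _ _ _ _ erefl); apply: arr_hcomp; expand_whiskers.
  by rewrite atens1a.
by rewrite atensa1.
Qed.

Lemma mate_tens X Y (s : hom (X ⊗ P) (P ⊗ X)) (t : hom (Y ⊗ P) (P ⊗ Y)) :
  mate (braid_tens s t) ===
  W [:: X] [:: Q; Y] [:: Y; Q] (mate t) [::] ∘
  W [::] [:: Q; X] [:: X; Q] (mate s) [:: Y].
Proof.
have Mx Z (r : hom (Z ⊗ P) (P ⊗ Z)) : mate r =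
   W [::] [:: Q; P] [::] (pev V) [:: Z; Q] ∘
   W [:: Q] [:: Z; P] [:: P; Z] r [:: Q] ∘
   W [:: Q; Z] [::] [:: P; Q] (pcoev V) [::].
  apply: arr_inj; rewrite (@mateE [:: Z] r r erefl erefl erefl).
  by rewrite !hcompE.
rewrite (@mateE [:: X; Y] _ _ erefl erefl (braid_tensE s t)).
rewrite !hcompE !Mx.
congr arr; normalize_whiskers.
have evK : W [:: Q; X; P] [:: Q; P] [::] (pev V) [:: Y; Q] ∘
    W [:: Q; X] [::] [:: P; Q] (pcoev V) [:: P; Y; Q] =
    idm (word [:: Q; X; P; Y; Q]).
  have := f_equal (fun h => W [:: Q; X] _ _ h [:: Y; Q]) zigzag_p.
  by rewrite /= (whisker_id [:: Q; X] [:: P]); normalize_whiskers.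
slide_l (@nil C) [:: Q; P] (@nil C) (pev V) [:: X; Q; Y]
      (@nil C) [:: P; Q] (pcoev V) (@nil C).
slide_l (@nil C) [:: Q; P] (@nil C) (pev V) [:: X; Q]
      [:: Y; P] [:: P; Y] t [:: Q].
slide_l (@nil C) [:: Q; P] (@nil C) (pev V) [:: X]
      [:: Q; P] (@nil C) (pev V) [:: Y; Q].
slide_l [:: Q] [:: X; P] [:: P; X] s [:: Q; Y]
      (@nil C) [:: P; Q] (pcoev V) (@nil C).
slide_l [:: Q] [:: X; P] [:: P; X] s [:: Q]
      [:: Y; P] [:: P; Y] t [:: Q].
slide_l [:: Q] [:: X; P] [:: P; X] s (@nil C)
      [:: Q; P] (@nil C) (pev V) [:: Y; Q].
slide_l [:: Q; X] (@nil C) [:: P; Q] (pcoev V) [:: Y]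
      (@nil C) [:: P; Q] (pcoev V) (@nil C).
slide_l [:: Q; X] (@nil C) [:: P; Q] (pcoev V) (@nil C)
      [:: Y; P] [:: P; Y] t [:: Q].
by rewrite_comp evK.
Qed.

Definition braid_tens' X Y (s : hom (P ⊗ X) (X ⊗ P)) (t : hom (P ⊗ Y) (Y ⊗ P)) :
    hom (P ⊗ (X ⊗ Y)) (X ⊗ Y ⊗ P) :=
  cast ((idm X ⊠ t) ⊚ (s ⊠ idm Y)).

Lemma braid_tensE' X Y (s : hom (P ⊗ X) (X ⊗ P)) (t : hom (P ⊗ Y) (Y ⊗ P)) :
  braid_tens' s t ===
  W [:: X] [:: P; Y] [:: Y; P] t [::] ∘ W [::] [:: P; X] [:: X; P] s [:: Y].
Proof.
rewrite arr_cast -(@hcompE _ _ _ _ erefl); apply: arr_hcomp; expand_whiskers.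
  by rewrite atensa1.
by rewrite atens1a.
Qed.

Lemma comate_tens X Y (s : hom (P ⊗ X) (X ⊗ P)) (t : hom (P ⊗ Y) (Y ⊗ P)) :
  comate (braid_tens' s t) ===
  W [::] [:: X; Q] [:: Q; X] (comate s) [:: Y] ∘
  W [:: X] [:: Y; Q] [:: Q; Y] (comate t) [::].
Proof.
have Nx Z (r : hom (P ⊗ Z) (Z ⊗ P)) : comate r =
   W [:: Q; Z] [:: P; Q] [::] (pev_r V) [::] ∘
   W [:: Q] [:: P; Z] [:: Z; P] r [:: Q] ∘
   W [::] [::] [:: Q; P] (pcoev_r V) [:: Z; Q].
  apply: arr_inj; rewrite (@comateE [:: Z] r r erefl erefl erefl).
  by rewrite !hcompE.
rewrite (@comateE [:: X; Y] _ _ erefl erefl (braid_tensE' s t)).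
rewrite !hcompE !Nx.
congr arr; normalize_whiskers.
have evK : W [:: Q; X] [:: P; Q] [::] (pev_r V) [:: P; Y; Q] ∘
    W [:: Q; X; P] [::] [:: Q; P] (pcoev_r V) [:: Y; Q] =
    idm (word [:: Q; X; P; Y; Q]).
  have := f_equal (fun h => W [:: Q; X] _ _ h [:: Y; Q]) zigzag_r_p.
  by rewrite /= (whisker_id [:: Q; X] [:: P]); normalize_whiskers.
slide_r (@nil C) (@nil C) [:: Q; P] (pcoev_r V) [:: X; Q; Y]
      [:: P; Q] (@nil C) (pev_r V) (@nil C).
slide_r (@nil C) (@nil C) [:: Q; P] (pcoev_r V) [:: X; Q]
      [:: P; Y] [:: Y; P] t [:: Q].
slide_r (@nil C) (@nil C) [:: Q; P] (pcoev_r V) [:: X]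
      (@nil C) [:: Q; P] (pcoev_r V) [:: Y; Q].
slide_r [:: Q] [:: P; X] [:: X; P] s [:: Q; Y]
      [:: P; Q] (@nil C) (pev_r V) (@nil C).
slide_r [:: Q] [:: P; X] [:: X; P] s [:: Q]
      [:: P; Y] [:: Y; P] t [:: Q].
slide_r [:: Q] [:: P; X] [:: X; P] s (@nil C)
      (@nil C) [:: Q; P] (pcoev_r V) [:: Y; Q].
slide_r [:: Q; X] [:: P; Q] (@nil C) (pev_r V) [:: Y]
      [:: P; Q] (@nil C) (pev_r V) (@nil C).
slide_r [:: Q; X] [:: P; Q] (@nil C) (pev_r V) (@nil C)
      [:: P; Y] [:: Y; P] t [:: Q].
by rewrite_comp evK.
Qed.

Lemma mate_one : mate braid_one === idm Q.
Proof.
have E : braid_one === idm (word [:: P]) by rewrite arr_cast.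
rewrite (@mateE [::] _ _ erefl erefl E) !hcompE; congr arr => /=.
by rewrite (whisker_id [:: Q] [:: P] [:: Q]) compm1; exact: zigzag_q.
Qed.

Lemma comate_one (s : hom (P ⊗ one) (one ⊗ P)) :
  s === idm P -> comate s === idm Q.
Proof.
move=> E; rewrite (@comateE [::] _ (idm (word [:: P])) erefl erefl E) !hcompE.
congr arr => /=.
by rewrite (whisker_id [:: Q] [:: P] [:: Q]) compm1; exact: zigzag_r_q.
Qed.

Lemma comp_arr_id X Y (g : hom Y X) (f : hom X Y) Z (g' f' : hom Z Z) :
  g === g' -> f === f' -> g' ∘ f' = idm Z -> X = Z -> g ∘ f = idm X.
Proof.
move=> Eg Ef E eX; apply: arr_inj.
by rewrite (arr_comp Eg Ef) E eX.
Qed.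

Lemma braid_oneP : braidP braid_one.
Proof.
have Es : braid_one === idm P by rewrite arr_cast.
have Es' : braid_one' === idm P by rewrite arr_cast.
have id2 X : idm X ∘ idm X = idm X by exact: comp1m.
exists braid_one'; split; split.
- by apply: (comp_arr_id Es' Es); rewrite ?comp1m ?tens1o.
- by apply: (comp_arr_id Es Es'); rewrite ?comp1m ?tenso1.
- by apply: (comp_arr_id (comate_one Es') mate_one); rewrite ?comp1m ?tenso1.
by apply: (comp_arr_id mate_one (comate_one Es')); rewrite ?comp1m ?tens1o.
Qed.

Lemma braid_tensP X Y (s : hom (X ⊗ P) (P ⊗ X)) (t : hom (Y ⊗ P) (P ⊗ Y)) :
  braidP s -> braidP t -> braidP (braid_tens s t).
Proof.
move=> [s' [[sK s'K] [msK ms'K]]] [t' [[tK t'K] [mtK mt'K]]].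
have whiskK (l a b : seq C) (g : hom (word b) (word a)) (f : hom (word a) (word b)) r :
      g ∘ f = idm (word a) -> W l b a g r ∘ W l a b f r = idm _.
  by move=> E; rewrite -whisker_comp E whisker_id.
exists (braid_tens' s' t'); split; split; apply: arr_inj.
- rewrite (arr_comp (braid_tensE' s' t') (braid_tensE s t)) -!compA.
  rewrite_comp (whiskK [::] [:: X; P] [:: P; X] s' s [:: Y] sK).
  by rewrite_comp (whiskK [:: X] [:: Y; P] [:: P; Y] t' t [::] tK); rewrite tensA.
- rewrite (arr_comp (braid_tensE s t) (braid_tensE' s' t')) -!compA.
  rewrite_comp (whiskK [:: X] [:: P; Y] [:: Y; P] t t' [::] t'K).
  by rewrite_comp (whiskK [::] [:: P; X] [:: X; P] s s' [:: Y] s'K).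
- rewrite (arr_comp (comate_tens s' t') (mate_tens s t)) -!compA.
  rewrite_comp (whiskK [:: X] [:: Q; Y] [:: Y; Q] _ _ [::] mtK).
  by rewrite_comp (whiskK [::] [:: Q; X] [:: X; Q] _ _ [:: Y] msK).
rewrite (arr_comp (mate_tens s t) (comate_tens s' t')) -!compA.
rewrite_comp (whiskK [::] [:: X; Q] [:: Q; X] _ _ [:: Y] ms'K).
by rewrite_comp (whiskK [:: X] [:: Y; Q] [:: Q; Y] _ _ [::] mt'K); rewrite tensA.
Qed.

Lemma braid_tens_natural X X' Y Y' (s : hom (X ⊗ P) (P ⊗ X))
    (s1 : hom (X' ⊗ P) (P ⊗ X')) (t : hom (Y ⊗ P) (P ⊗ Y))
    (t1 : hom (Y' ⊗ P) (P ⊗ Y')) (f : hom X X') (g : hom Y Y') :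
  s1 ∘ (f ⊠ idm P) = (idm P ⊠ f) ∘ s ->
  t1 ∘ (g ⊠ idm P) = (idm P ⊠ g) ∘ t ->
  braid_tens s1 t1 ∘ (f ⊠ g ⊠ idm P) = (idm P ⊠ (f ⊠ g)) ∘ braid_tens s t.
Proof.
have wr U U' (h : hom U U') : W [::] [:: U] [:: U'] h [:: P] = h ⊠ idm P.
  by apply: arr_inj; expand_whiskers; rewrite /= atens1a.
have wl U U' (h : hom U U') : W [:: P] [:: U] [:: U'] h [::] = idm P ⊠ h.
  by apply: arr_inj; expand_whiskers; rewrite /= atensa1.
have Efg : f ⊠ g ⊠ idm P ===
    W [:: X'] [:: Y] [:: Y'] g [:: P] ∘ W [::] [:: X] [:: X'] f [:: Y; P].
  have -> : f ⊠ g ⊠ idm P =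
      (idm X' ⊠ g ⊠ idm P) ∘ (f ⊠ idm Y ⊠ idm P).
    by rewrite -!tenm_comp !comp1m compm1.
  apply: arr_comp; expand_whiskers => //.
  by rewrite /= arr_idm_tens atens1a atensA.
have Epfg : idm P ⊠ (f ⊠ g) ===
    W [:: P] [:: X] [:: X'] f [:: Y'] ∘ W [:: P; X] [:: Y] [:: Y'] g [::].
  have -> : idm P ⊠ (f ⊠ g) =
      (idm P ⊠ (f ⊠ idm Y')) ∘ (idm P ⊠ (idm X ⊠ g)).
    by rewrite -!tenm_comp !comp1m compm1.
  apply: arr_comp; expand_whiskers; rewrite !atensE atensA //.
  by rewrite /= arr_idm_tens atensa1.
move=> Es Et; rewrite -!wr -!wl in Es Et.
apply: arr_inj.
rewrite (arr_comp (braid_tensE s1 t1) Efg) (arr_comp Epfg (braid_tensE s t)).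
have {}Es := f_equal (fun h : hom (word [:: X; P]) (word [:: P; X']) =>
  W [::] [:: X; P] [:: P; X'] h [:: Y']) Es.
have {}Et := f_equal (fun h : hom (word [:: Y; P]) (word [:: P; Y']) =>
  W [:: X'] [:: Y; P] [:: P; Y'] h [::]) Et.
move: Es Et => /=.
rewrite (@whisker_comp _ [::] [:: X; P] [:: P; X] [:: P; X'] _ s [:: Y']).
rewrite (@whisker_comp _ [:: X'] [:: Y; P] [:: P; Y] [:: P; Y'] _ t [::]).
normalize_whiskers => Es Et; congr arr; rewrite -?compA /=.
rewrite_comp Et.
slide_l (@nil C) [:: X] [:: X'] f (@nil C) [:: Y; P] [:: P; Y] t (@nil C).
slide_l (@nil C) [:: X] [:: X'] f [:: P] [:: Y] [:: Y'] g (@nil C).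
rewrite_comp Es.
by slide_r (@nil C) [:: X; P] [:: P; X] s (@nil C) [:: Y] [:: Y'] g (@nil C).
Qed.

Lemma braid_tensA X Y Z (s : hom (X ⊗ P) (P ⊗ X)) (t : hom (Y ⊗ P) (P ⊗ Y))
    (u : hom (Z ⊗ P) (P ⊗ Z)) :
  braid_tens s (braid_tens t u) === braid_tens (braid_tens s t) u.
Proof.
have EL : braid_tens s (braid_tens t u) ===
    W [::] [:: X; P] [:: P; X] s [:: Y; Z] ∘
    W [:: X] [:: Y; Z; P] [:: P; Y; Z]
      (W [::] [:: Y; P] [:: P; Y] t [:: Z] ∘
       W [:: Y] [:: Z; P] [:: P; Z] u [::]) [::].
  rewrite arr_cast -(@hcompE _ _ _ _ erefl); apply: arr_hcomp.
    by expand_whiskers; rewrite /= atens1a.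
  by rewrite (@arr_whisker _ [:: X] [:: Y; Z; P] [:: P; Y; Z] _ [::]) /=
    atensa1 atensE braid_tensE.
have ER : braid_tens (braid_tens s t) u ===
    W [::] [:: X; Y; P] [:: P; X; Y]
      (W [::] [:: X; P] [:: P; X] s [:: Y] ∘
       W [:: X] [:: Y; P] [:: P; Y] t [::]) [:: Z] ∘
    W [:: X; Y] [:: Z; P] [:: P; Z] u [::].
  rewrite arr_cast -(@hcompE _ _ _ _ erefl); apply: arr_hcomp.
    by rewrite (@arr_whisker _ [::] [:: X; Y; P] [:: P; X; Y] _ [:: Z]) /=
      atens1a atensE braid_tensE.
  by expand_whiskers; rewrite /= atensa1.
by rewrite EL ER; congr arr; normalize_whiskers.
Qed.

Lemma braid_tens1 Y (t : hom (Y ⊗ P) (P ⊗ Y)) : braid_tens braid_one t === t.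
Proof.
rewrite -[t in RHS]comp1m arr_cast -(@hcompE _ _ _ _ erefl).
apply: arr_hcomp; last by rewrite atensE atens1a.
by rewrite atensE arr_cast arr_idm_tens.
Qed.

Lemma braid_tens1r X (s : hom (X ⊗ P) (P ⊗ X)) : braid_tens s braid_one === s.
Proof.
rewrite -[s in RHS]compm1 arr_cast -(@hcompE _ _ _ _ erefl).
apply: arr_hcomp; first by rewrite atensE atensa1.
by rewrite atensE arr_cast arr_idm_tens.
Qed.

Lemma cpq_ob_eq (A B : cpq_ob V) : cpo A = cpo B -> cpb A === cpb B -> A = B.
Proof.
case: A B => X s Ps [Y t Pt] /= E; case: _ / E t Pt => t Pt /arr_inj E.
by case: _ / E Pt => Pt; rewrite (proof_irrelevance _ Ps Pt).
Qed.

Lemma cpq_hom_eq (A B : cpq_ob V) (f g : cpq_hom A B) : cpf f = cpf g -> f = g.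
Proof.
case: f g => f Pf [g Pg] /= E; case: _ / E Pg => Pg.
by rewrite (proof_irrelevance _ Pf Pg).
Qed.

Lemma cpq_idP (A : cpq_ob V) :
  cpb A ∘ (idm (cpo A) ⊠ idm P) = (idm P ⊠ idm (cpo A)) ∘ cpb A.
Proof. by rewrite !tenm_id comp1m compm1. Qed.

Lemma cpq_compP (A B D : cpq_ob V) (g : cpq_hom B D) (f : cpq_hom A B) :
  cpb D ∘ ((cpf g ∘ cpf f) ⊠ idm P) = (idm P ⊠ (cpf g ∘ cpf f)) ∘ cpb A.
Proof.
rewrite -[idm P in LHS]comp1m -[idm P in RHS]comp1m !tenm_comp.
by rewrite compA cpfP -!compA cpfP.
Qed.

Definition cpq_id (A : cpq_ob V) : cpq_hom A A := CpqHom (cpq_idP A).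

Definition cpq_comp (A B D : cpq_ob V) (g : cpq_hom B D) (f : cpq_hom A B) :
  cpq_hom A D := CpqHom (cpq_compP g f).

Definition cpq_cat : category.
Proof.
refine (@Category (cpq_ob V) (@cpq_hom C V) cpq_id cpq_comp _ _ _).
- by move=> A B D E h g f; apply: cpq_hom_eq; exact: compA.
- by move=> A B f; apply: cpq_hom_eq; exact: comp1m.
- by move=> A B f; apply: cpq_hom_eq; exact: compm1.
Defined.

Definition cpq_one : cpq_ob V := CpqOb braid_oneP.

Definition cpq_tens (A B : cpq_ob V) : cpq_ob V :=
  CpqOb (braid_tensP (cpbP A) (cpbP B)).

Definition cpq_tenm (A B A' B' : cpq_ob V) (f : cpq_hom A B)
    (g : cpq_hom A' B') : cpq_hom (cpq_tens A A') (cpq_tens B B') :=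
  @CpqHom C V (cpq_tens A A') (cpq_tens B B') (cpf f ⊠ cpf g)
    (braid_tens_natural (cpfP f) (cpfP g)).

Lemma cpq_tensA (A B D : cpq_ob V) :
  cpq_tens A (cpq_tens B D) = cpq_tens (cpq_tens A B) D.
Proof. by apply: cpq_ob_eq; [exact: tensA | exact: braid_tensA]. Qed.

Lemma cpq_tens1o (A : cpq_ob V) : cpq_tens cpq_one A = A.
Proof. by apply: cpq_ob_eq; [exact: tens1o | exact: braid_tens1]. Qed.

Lemma cpq_tenso1 (A : cpq_ob V) : cpq_tens A cpq_one = A.
Proof. by apply: cpq_ob_eq; [exact: tenso1 | exact: braid_tens1r]. Qed.

Lemma cpq_arr_eq (A B A' B' : cpq_cat) (f : hom A B) (g : hom A' B') :
  A = A' -> B = B' -> cpf f === cpf g -> f === g.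
Proof.
move=> eA eB; case: _ / eA g => g; case: _ / eB g => g /arr_inj E.
by congr arr; exact: cpq_hom_eq.
Qed.

Definition cpq : strict_monoidal.
Proof.
refine (@StrictMonoidal cpq_cat cpq_one cpq_tens cpq_tenm
          _ _ cpq_tensA cpq_tens1o cpq_tenso1 _ _ _).
- by move=> A B; apply: cpq_hom_eq; exact: tenm_id.
- by move=> *; apply: cpq_hom_eq; exact: tenm_comp.
- by move=> *; apply: cpq_arr_eq; [exact: cpq_tensA .. | exact: tenmA].
- by move=> *; apply: cpq_arr_eq; [exact: cpq_tens1o .. | exact: tenm1m].
- by move=> *; apply: cpq_arr_eq; [exact: cpq_tenso1 .. | exact: tenmm1].
Defined.

End Cpq.

(* Main.v *)
From mathcomp Require Import all_boot.
Require Import Defs.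

(** Write X -| Y when Y is a left dual of X, so that its evaluation is a map
Y ⊗ X -> 1.  The structure of the pivotal pair P, Q consists of a duality
P -| Q, given by ev and coev, and a duality Q -| P, given by the underlined
maps.

Bending along A -| B turns g : X ⊗ A -> A ⊗ X into a map B ⊗ X -> X ⊗ B, and
is a bijection ([bendK], [unbendK]).  The mate of s is its bend along P -| Q,
and the comate of s^-1 is its unbend along Q -| P.  So instead of s^-1 one may
record n : X ⊗ Q -> Q ⊗ X, the comate of s^-1, and an object of C(P,Q)
becomes a triple (X, s, n) with s : X ⊗ P -> P ⊗ X and n : X ⊗ Q -> Q ⊗ X such
that
  s is inverse to the bend of n, and n is inverse to the bend of s
([braidP_inverse_mates]).  This description is symmetric in P and Q.

Let X -| Y.  Transposition f |-> f^t is a contravariant bijection on morphisms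
that respects composition.  As the left dual of X ⊗ P is Q ⊗ Y and that of
X ⊗ Q is P ⊗ Y, the transposes are n^t : Y ⊗ P -> P ⊗ Y and
s^t : Y ⊗ Q -> Q ⊗ Y: they have the types required for a triple (Y, n^t, s^t)
over Y.  The key identity is that transposition intertwines the
two bends,
  bend_(Q -| P) (g^t) = (bend_(P -| Q) g)^t
([bend_transpose]), and likewise with P and Q exchanged.  Hence (X, s, n)
satisfies the two conditions above if and only if (Y, n^t, s^t) does, the
conditions being exchanged ([inverse_mates_transpose]).

Finally the evaluation and coevaluation of X -| Y are morphisms of C(P,Q)
between the triples so related: each of these statements is one zigzag for
X -| Y ([ev_transpose], [coev_transpose]).  Since C(P,Q) composes and tensors
morphisms as C does, (Y, n^t, s^t) is then a left dual of (X, s, n)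
([cpq_left_dual]).  A right dual of a triple over Y is found in the same way,
starting from X -| Y: its triple over X is the one whose transpose is given. *)

Set Implicit Arguments.
Unset Strict Implicit.
Unset Printing Implicit Defensive.
Local Open Scope cat_scope.

(* [a] is the word on which the zigzag identity [z] is an identity; it has to be
   given because unification cannot find it. *)
Ltac cancel_zigzag l a r z :=
  let E := fresh in
  pose proof (E := f_equal (fun h => whisker l a a h r) z);
  rewrite /= (@whisker_id _ l a r) /= in E;
  move: E; normalize_whiskers => E; rewrite_comp E; clear E.

(** * Dual objects *)

Section Dualities.
Context {C : strict_monoidal}.
Implicit Types A B X Y : C.
Local Notation W := whisker.

(** The equations [eX] and [eY] are free so that, for words of explicit shape,
they can be taken to be [erefl], which makes the casts compute away. *)
Lemma whisker_nil (a b : seq C) (f : hom (word a) (word b))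
    (eX : obj_eq _ (word a)) (eY : obj_eq _ (word b)) :
  cast (eX := eX) (eY := eY) (W [::] a b f [::]) = f.
Proof. by apply: arr_inj; rewrite arr_cast arr_whisker /= atens1a atensa1. Qed.

Record duality X Y := Duality {
  dev : hom (Y ⊗ X) one;
  dcoev : hom one (X ⊗ Y);
  dualP : is_left_dual dev dcoev
}.

Lemma zigzag_left X Y (d : duality X Y) :
  W [:: X] [:: Y; X] [::] (dev d) [::] ∘
  W [::] [::] [:: X; Y] (dcoev d) [:: X] = idm (word [:: X]).
Proof.
apply: arr_inj; rewrite -(proj2 (dualP d)) -(@hcompE _ _ _ _ erefl).
by apply: arr_hcomp; expand_whiskers; rewrite /= ?(atensa1, atens1a).
Qed.

Lemma zigzag_right X Y (d : duality X Y) :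
  W [::] [:: Y; X] [::] (dev d) [:: Y] ∘
  W [:: Y] [::] [:: X; Y] (dcoev d) [::] = idm (word [:: Y]).
Proof.
apply: arr_inj; rewrite -(proj1 (dualP d)) -(@hcompE _ _ _ _ erefl).
by apply: arr_hcomp; expand_whiskers; rewrite /= ?(atensa1, atens1a).
Qed.

(** * Bending and transposing morphisms *)

(** The mate construction of C(P,Q), along an arbitrary duality. *)
Definition bend A B (d : duality A B) X (g : hom (X ⊗ A) (A ⊗ X)) :
    hom (B ⊗ X) (X ⊗ B) :=
  W [::] [:: B; A] [::] (dev d) [:: X; B] ∘
  W [:: B] [:: X; A] [:: A; X] g [:: B] ∘
  W [:: B; X] [::] [:: A; B] (dcoev d) [::].

Definition unbend A B (d : duality A B) X (f : hom (B ⊗ X) (X ⊗ B)) :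
    hom (X ⊗ A) (A ⊗ X) :=
  W [:: A; X] [:: B; A] [::] (dev d) [::] ∘
  W [:: A] [:: B; X] [:: X; B] f [:: A] ∘
  W [::] [::] [:: A; B] (dcoev d) [:: X; A].

(** The interchange law pulls the two zigzags formed by the doubly bent legs of
[g] away from [g], and each is then straightened. *)
Lemma bendK A B (d : duality A B) X : cancel (@bend A B d X) (@unbend A B d X).
Proof.
move=> g; rewrite /unbend /bend; normalize_whiskers.
slide_l [:: A] [:: B; A] (@nil C) (dev d) [:: X]
  [:: B; A] (@nil C) (dev d) (@nil C).
slide_l [:: A; B] [:: X; A] [:: A; X] g (@nil C)
  [:: B; A] (@nil C) (dev d) (@nil C).
cancel_zigzag [:: A; B; X] [:: A] (@nil C) (zigzag_left d).
slide_l (@nil C) (@nil C) [:: A; B] (dcoev d) (@nil C)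
  [:: X; A] [:: A; X] g (@nil C).
cancel_zigzag (@nil C) [:: A] [:: X] (zigzag_left d).
exact: (@whisker_nil [:: X; A] [:: A; X] _ erefl erefl).
Qed.

Lemma unbendK A B (d : duality A B) X :
  cancel (@unbend A B d X) (@bend A B d X).
Proof.
move=> f; rewrite /unbend /bend; normalize_whiskers.
slide_r [:: B] (@nil C) [:: A; B] (dcoev d) [:: X]
  (@nil C) [:: A; B] (dcoev d) (@nil C).
slide_r [:: B; A] [:: B; X] [:: X; B] f (@nil C)
  (@nil C) [:: A; B] (dcoev d) (@nil C).
cancel_zigzag [:: B; A; X] [:: B] (@nil C) (zigzag_right d).
slide_r (@nil C) [:: B; A] (@nil C) (dev d) (@nil C)
  [:: B; X] [:: X; B] f (@nil C).
cancel_zigzag (@nil C) [:: B] [:: X] (zigzag_right d).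
rewrite compm1; exact: (@whisker_nil [:: B; X] [:: X; B] _ erefl erefl).
Qed.

Definition transpose A B A' B' (d : duality A B) (d' : duality A' B')
    (f : hom A A') : hom B' B :=
  W [::] [:: B'; A'] [::] (dev d') [:: B] ∘
  W [:: B'] [:: A] [:: A'] f [:: B] ∘
  W [:: B'] [::] [:: A; B] (dcoev d) [::].

Definition cotranspose A B A' B' (d : duality A B) (d' : duality A' B')
    (g : hom B' B) : hom A A' :=
  W [:: A'] [:: B; A] [::] (dev d) [::] ∘
  W [:: A'] [:: B'] [:: B] g [:: A] ∘
  W [::] [::] [:: A'; B'] (dcoev d') [:: A].

Lemma transposeK A B A' B' (d : duality A B) (d' : duality A' B') :
  cancel (transpose d d') (cotranspose d d').
Proof.
move=> f; rewrite /cotranspose /transpose; normalize_whiskers.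
slide_l [:: A'] [:: B'; A'] (@nil C) (dev d') (@nil C)
  [:: B; A] (@nil C) (dev d) (@nil C).
slide_l [:: A'; B'] [:: A] [:: A'] f (@nil C)
  [:: B; A] (@nil C) (dev d) (@nil C).
cancel_zigzag [:: A'; B'] [:: A] (@nil C) (zigzag_left d).
slide_l (@nil C) (@nil C) [:: A'; B'] (dcoev d') (@nil C)
  [:: A] [:: A'] f (@nil C).
cancel_zigzag (@nil C) [:: A'] (@nil C) (zigzag_left d').
exact: (@whisker_nil [:: A] [:: A'] _ erefl erefl).
Qed.

Lemma cotransposeK A B A' B' (d : duality A B) (d' : duality A' B') :
  cancel (cotranspose d d') (transpose d d').
Proof.
move=> g; rewrite /cotranspose /transpose; normalize_whiskers.
slide_r [:: B'] (@nil C) [:: A'; B'] (dcoev d') (@nil C)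
  (@nil C) [:: A; B] (dcoev d) (@nil C).
slide_r [:: B'; A'] [:: B'] [:: B] g (@nil C)
  (@nil C) [:: A; B] (dcoev d) (@nil C).
cancel_zigzag [:: B'; A'] [:: B] (@nil C) (zigzag_right d).
slide_r (@nil C) [:: B'; A'] (@nil C) (dev d') (@nil C)
  [:: B'] [:: B] g (@nil C).
cancel_zigzag (@nil C) [:: B'] (@nil C) (zigzag_right d').
rewrite compm1; exact: (@whisker_nil [:: B'] [:: B] _ erefl erefl).
Qed.

Lemma transpose_id A B (d : duality A B) : transpose d d (idm A) = idm B.
Proof.
by rewrite /transpose (whisker_id [:: B] [:: A] [:: B]) compm1 zigzag_right.
Qed.

Lemma transpose_comp A B A' B' A'' B'' (d : duality A B) (d' : duality A' B')
    (d'' : duality A'' B'') (g : hom A' A'') (f : hom A A') :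
  transpose d d'' (g ∘ f) = transpose d d' f ∘ transpose d' d'' g.
Proof.
rewrite /transpose; normalize_whiskers.
rewrite (@whisker_comp _ [:: B''] [:: A] [:: A'] [:: A''] g f [:: B]) /=.
rewrite -?compA.
slide_l (@nil C) [:: B''; A''] (@nil C) (dev d'') [:: B']
  (@nil C) [:: A; B] (dcoev d) (@nil C).
slide_l (@nil C) [:: B''; A''] (@nil C) (dev d'') [:: B']
  [:: A] [:: A'] f [:: B].
slide_l (@nil C) [:: B''; A''] (@nil C) (dev d'') (@nil C)
  [:: B'; A'] (@nil C) (dev d') [:: B].
slide_l [:: B''] [:: A'] [:: A''] g [:: B']
  (@nil C) [:: A; B] (dcoev d) (@nil C).
slide_l [:: B''] [:: A'] [:: A''] g [:: B'] [:: A] [:: A'] f [:: B].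
slide_l [:: B''] [:: A'] [:: A''] g (@nil C)
  [:: B'; A'] (@nil C) (dev d') [:: B].
slide_l [:: B''] (@nil C) [:: A'; B'] (dcoev d') (@nil C)
  (@nil C) [:: A; B] (dcoev d) (@nil C).
slide_l [:: B''] (@nil C) [:: A'; B'] (dcoev d') (@nil C)
  [:: A] [:: A'] f [:: B].
by cancel_zigzag [:: B''] [:: A'] [:: B] (zigzag_left d').
Qed.

(** Transposition is contravariant, so it exchanges the two equations of
[mutual_inverse]; it also reflects them, being injective. *)
Lemma transpose_inverse A B A' B' (d : duality A B) (d' : duality A' B')
    (f : hom A A') (g : hom A' A) :
  mutual_inverse f g <-> mutual_inverse (transpose d' d g) (transpose d d' f).
Proof.
rewrite /mutual_inverse -!transpose_comp -!(transpose_id d) -!(transpose_id d').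
split=> [[-> ->] // | [E1 E2]].
by split; [move: E1 | move: E2]; apply: can_inj; exact: transposeK.
Qed.

(** * Duals of tensor products *)

(** Stated on the right-bracketed objects, which are those named by words, so
that the word calculus applies to it without casts. *)
Definition tens_ev X Y P Q (dX : duality X Y) (dP : duality P Q) :
    hom (Q ⊗ (Y ⊗ (X ⊗ P))) one :=
  dev dP ∘ W [:: Q] [:: Y; X] [::] (dev dX) [:: P].

Definition tens_coev X Y P Q (dX : duality X Y) (dP : duality P Q) :
    hom one (X ⊗ (P ⊗ (Q ⊗ Y))) :=
  W [:: X] [::] [:: P; Q] (dcoev dP) [:: Y] ∘
  W [::] [::] [:: X; Y] (dcoev dX) [::].

Lemma tens_dualP X Y P Q (dX : duality X Y) (dP : duality P Q) :
  is_left_dual (X := X ⊗ P) (Y := Q ⊗ Y)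
    (cast (tens_ev dX dP)) (cast (tens_coev dX dP)).
Proof.
set E := tens_ev dX dP; set K := tens_coev dX dP; split.
  transitivity (arr (W [::] [:: Q; Y; X; P] [::] E [:: Q; Y] ∘
                     W [:: Q; Y] [::] [:: X; P; Q; Y] K [::])).
    rewrite -(@hcompE _ _ _ _ erefl); apply: arr_hcomp.
      rewrite atensE arr_cast; expand_whiskers.
      by rewrite /= atens1a ?atensE.
    rewrite atensE arr_cast; expand_whiskers.
    by rewrite /= atensa1 ?atensE.
  congr arr; rewrite /E /K /tens_ev /tens_coev; normalize_whiskers.
  slide_r [:: Q] [:: Y; X] (@nil C) (dev dX) (@nil C)
    (@nil C) [:: P; Q] (dcoev dP) [:: Y].
  cancel_zigzag [:: Q] [:: Y] (@nil C) (zigzag_right dX).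
  by cancel_zigzag (@nil C) [:: Q] [:: Y] (zigzag_right dP).
transitivity (arr (W [:: X; P] [:: Q; Y; X; P] [::] E [::] ∘
                   W [::] [::] [:: X; P; Q; Y] K [:: X; P])).
  rewrite -(@hcompE _ _ _ _ erefl); apply: arr_hcomp.
    rewrite atensE arr_cast; expand_whiskers.
    by rewrite /= atensa1 ?atensE.
  rewrite atensE arr_cast; expand_whiskers.
  by rewrite /= atens1a ?atensE.
congr arr; rewrite /E /K /tens_ev /tens_coev; normalize_whiskers.
slide_l [:: X] (@nil C) [:: P; Q] (dcoev dP) (@nil C)
  [:: Y; X] (@nil C) (dev dX) [:: P].
cancel_zigzag (@nil C) [:: X] [:: P] (zigzag_left dX).
by cancel_zigzag [:: X] [:: P] (@nil C) (zigzag_left dP).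
Qed.

Definition duality_tens X Y P Q (dX : duality X Y) (dP : duality P Q) :
  duality (X ⊗ P) (Q ⊗ Y) := Duality (tens_dualP dX dP).

Lemma dev_tens X Y P Q (dX : duality X Y) (dP : duality P Q) :
  dev (duality_tens dX dP) === tens_ev dX dP.
Proof. exact: arr_cast. Qed.

Lemma dcoev_tens X Y P Q (dX : duality X Y) (dP : duality P Q) :
  dcoev (duality_tens dX dP) === tens_coev dX dP.
Proof. exact: arr_cast. Qed.

(** A transpose along tensor product dualities, drawn as a string diagram whose
strands are the tensor factors; the interchange law applies to this form. *)
Lemma transpose_tensE A1 A2 B1 B2 A1' A2' B1' B2'
    (d1 : duality A1 B1) (d2 : duality A2 B2)
    (d1' : duality A1' B1') (d2' : duality A2' B2')
    (f : hom (A1 ⊗ A2) (A1' ⊗ A2')) :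
  transpose (duality_tens d1 d2) (duality_tens d1' d2') f =
  W [::] [:: B2'; A2'] [::] (dev d2') [:: B2; B1] ∘
  W [:: B2'] [:: B1'; A1'] [::] (dev d1') [:: A2'; B2; B1] ∘
  W [:: B2'; B1'] [:: A1; A2] [:: A1'; A2'] f [:: B2; B1] ∘
  W [:: B2'; B1'; A1] [::] [:: A2; B2] (dcoev d2) [:: B1] ∘
  W [:: B2'; B1'] [::] [:: A1; B1] (dcoev d1) [::].
Proof.
apply: arr_inj.
transitivity (arr (
    W [::] [:: B2'; B1'; A1'; A2'] [::] (tens_ev d1' d2') [:: B2; B1] ∘
    W [:: B2'; B1'] [:: A1; A2] [:: A1'; A2'] f [:: B2; B1] ∘
    W [:: B2'; B1'] [::] [:: A1; A2; B2; B1] (tens_coev d1 d2) [::])).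
  by rewrite /transpose; apply: arr_comp; first apply: arr_comp;
    expand_whiskers; rewrite ?dev_tens ?dcoev_tens /= ?arr_idm_tens.
by congr arr; rewrite /tens_ev /tens_coev; normalize_whiskers.
Qed.

(** Both sides are the same string diagram: [g] with its X legs bent by
[dX], and its P legs bent by [dP] and then by [dQ].  On the left [dP] is used
by the transpose and [dQ] by the bend, on the right conversely. *)
Lemma bend_transpose X Y P Q (dX : duality X Y) (dP : duality P Q)
    (dQ : duality Q P) (g : hom (X ⊗ P) (P ⊗ X)) :
  bend dQ (transpose (duality_tens dX dP) (duality_tens dP dX) g) =
  transpose (duality_tens dQ dX) (duality_tens dX dQ) (bend dP g).
Proof. by rewrite !transpose_tensE /bend; normalize_whiskers. Qed.

(** Moving a strand labelled B past the evaluation: crossing Y by the transpose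
of [f] amounts to crossing X by its bend, because the transpose contains a
coevaluation that the evaluation [dev dX] of the composite cancels. *)
Lemma ev_transpose X Y A B (dX : duality X Y) (dA : duality A B)
    (f : hom (X ⊗ A) (A ⊗ X)) :
  W [:: B] [:: Y; X] [::] (dev dX) [::] ∘
  W [::] [:: Y; B] [:: B; Y]
    (transpose (duality_tens dX dA) (duality_tens dA dX) f) [:: X] =
  W [::] [:: Y; X] [::] (dev dX) [:: B] ∘
  W [:: Y] [:: B; X] [:: X; B] (bend dA f) [::].
Proof.
rewrite transpose_tensE /bend; normalize_whiskers.
slide_l (@nil C) [:: Y; X] (@nil C) (dev dX) [:: B]
  [:: Y; X] (@nil C) (dev dX) (@nil C).
slide_l [:: Y] [:: B; A] (@nil C) (dev dA) [:: X; B]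
  [:: Y; X] (@nil C) (dev dX) (@nil C).
slide_l [:: Y; B] [:: X; A] [:: A; X] f [:: B]
  [:: Y; X] (@nil C) (dev dX) (@nil C).
slide_l [:: Y; B; X] (@nil C) [:: A; B] (dcoev dA) (@nil C)
  [:: Y; X] (@nil C) (dev dX) (@nil C).
by cancel_zigzag [:: Y; B] [:: X] (@nil C) (zigzag_left dX); rewrite ?compm1.
Qed.

(** Here the evaluation contained in the transpose cancels the coevaluation
[dcoev dX] of the composite. *)
Lemma coev_transpose X Y A B (dX : duality X Y) (dA : duality A B)
    (f : hom (X ⊗ A) (A ⊗ X)) :
  W [:: X] [:: Y; B] [:: B; Y]
    (transpose (duality_tens dX dA) (duality_tens dA dX) f) [::] ∘
  W [::] [::] [:: X; Y] (dcoev dX) [:: B] =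
  W [::] [:: B; X] [:: X; B] (bend dA f) [:: Y] ∘
  W [:: B] [::] [:: X; Y] (dcoev dX) [::].
Proof.
rewrite transpose_tensE /bend; normalize_whiskers.
slide_l (@nil C) (@nil C) [:: X; Y] (dcoev dX) [:: B]
  (@nil C) [:: X; Y] (dcoev dX) (@nil C).
slide_l (@nil C) (@nil C) [:: X; Y] (dcoev dX) [:: B; X]
  (@nil C) [:: A; B] (dcoev dA) [:: Y].
slide_l (@nil C) (@nil C) [:: X; Y] (dcoev dX) [:: B]
  [:: X; A] [:: A; X] f [:: B; Y].
slide_l (@nil C) (@nil C) [:: X; Y] (dcoev dX) (@nil C)
  [:: B; A] (@nil C) (dev dA) [:: X; B; Y].
by cancel_zigzag (@nil C) [:: X] [:: B; Y] (zigzag_left dX).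
Qed.

End Dualities.

(** * Duals in C(P,Q) *)

Section Rigidity.
Context {C : strict_monoidal} (V : pivotal_pair C).
Implicit Types X Y : C.
Local Notation P := (pp V).
Local Notation Q := (pq V).
Local Notation W := whisker.

Definition duality_pq : duality P Q := Duality (pdual V).
Definition duality_qp : duality Q P := Duality (pdual_r V).

Lemma mate_bend X (s : hom (X ⊗ P) (P ⊗ X)) : mate s = bend duality_pq s.
Proof.
by apply: arr_inj; rewrite (@mateE _ _ [:: X] s s erefl erefl erefl) !hcompE.
Qed.

Lemma comate_unbend X (s : hom (P ⊗ X) (X ⊗ P)) :
  comate s = unbend duality_qp s.
Proof.
by apply: arr_inj; rewrite (@comateE _ _ [:: X] s s erefl erefl erefl) !hcompE.
Qed.

(** The condition defining the objects of C(P,Q), with the comate [n] of the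
inverse of [s] in place of that inverse; it is symmetric in P and Q. *)
Definition inverse_mates X (s : hom (X ⊗ P) (P ⊗ X))
    (n : hom (X ⊗ Q) (Q ⊗ X)) : Prop :=
  mutual_inverse s (bend duality_qp n) /\ mutual_inverse (bend duality_pq s) n.

Lemma braidP_inverse_mates X (s : hom (X ⊗ P) (P ⊗ X)) :
  braidP s <-> exists n, inverse_mates s n.
Proof.
split=> [[s' []]|[n [Es En]]].
  rewrite mate_bend comate_unbend => Es En; exists (unbend duality_qp s').
  by split; rewrite ?unbendK.
by exists (bend duality_qp n); split; rewrite // mate_bend comate_unbend bendK.
Qed.

(** By [bend_transpose] each condition on the right is the transpose of the
other condition on the left. *)
Lemma inverse_mates_transpose X Y (d : duality X Y)
    (s : hom (X ⊗ P) (P ⊗ X)) (n : hom (X ⊗ Q) (Q ⊗ X)) :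
  inverse_mates s n <->
  inverse_mates
    (transpose (duality_tens d duality_qp) (duality_tens duality_qp d) n)
    (transpose (duality_tens d duality_pq) (duality_tens duality_pq d) s).
Proof.
rewrite /inverse_mates !bend_transpose.
split=> -[E1 E2]; split.
- exact: (proj1 (transpose_inverse _ _ _ _) E2).
- exact: (proj1 (transpose_inverse _ _ _ _) E1).
- exact: (proj2 (transpose_inverse _ _ _ _) E2).
exact: (proj2 (transpose_inverse _ _ _ _) E1).
Qed.

(** The forgetful functor from C(P,Q) is strict monoidal and, by [cpq_arr_eq],
faithful, so the triangle identities can be checked in C. *)
Lemma cpf_hcomp (A B B' D : cpq V) (e : obj_eq B B')
    (g : hom B' D) (f : hom A B) :
  cpf (g ⊚ f) === hcomp (e := f_equal (@cpo C V) e) (cpf g) (cpf f).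
Proof. by case: _ / e g => g; rewrite !hcompE. Qed.

Lemma cpq_is_left_dual (A B : cpq V) (ev : hom (B ⊗ A) one)
    (coev : hom one (A ⊗ B)) :
  is_left_dual (X := cpo A) (Y := cpo B) (cpf ev) (cpf coev) ->
  is_left_dual ev coev.
Proof.
case=> zl zr; split; apply: cpq_arr_eq; rewrite ?tens1o ?tenso1 //.
  by rewrite cpf_hcomp -[RHS]zl; apply: arr_hcomp.
by rewrite cpf_hcomp -[RHS]zr; apply: arr_hcomp.
Qed.

(** The braiding of [A] is cancelled by the bend of [n] that [ev_transpose] and
[coev_transpose] produce, so that [dev d] and [dcoev d] commute with the
braidings. *)
Lemma cpq_left_dual (A B : cpq V) (d : duality (cpo A) (cpo B))
    (n : hom (cpo A ⊗ Q) (Q ⊗ cpo A)) :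
  mutual_inverse (cpb A) (bend duality_qp n) ->
  cpb B = transpose (duality_tens d duality_qp) (duality_tens duality_qp d) n ->
  left_dual A B.
Proof.
case: A B d n => X s Ps [Y t Pt] /= d n [sK s'K] Et.
have evP : braid_one V ∘ (dev d ⊠ idm P) = (idm P ⊠ dev d) ∘ braid_tens t s.
  have sKY : W [:: Y] [:: P; X] [:: X; P] (bend duality_qp n) [::] ∘
      W [:: Y] [:: X; P] [:: P; X] s [::] = idm _.
    by rewrite -whisker_comp sK (whisker_id [:: Y] [:: X; P]).
  have eE : idm P ⊠ dev d === W [:: P] [:: Y; X] [::] (dev d) [::].
    by expand_whiskers; rewrite /= atensa1.
  apply: arr_inj; rewrite (arr_comp eE (braid_tensE t s)) Et compA.
  rewrite (ev_transpose d duality_qp n) -compA sKY compm1.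
  rewrite -[X in _ = arr X]comp1m; apply: arr_comp; first exact: arr_cast.
  by expand_whiskers; rewrite /= atens1a.
have coevP :
    braid_tens s t ∘ (dcoev d ⊠ idm P) = (idm P ⊠ dcoev d) ∘ braid_one V.
  have s'KY : W [::] [:: X; P] [:: P; X] s [:: Y] ∘
      W [::] [:: P; X] [:: X; P] (bend duality_qp n) [:: Y] = idm _.
    by rewrite -whisker_comp s'K (whisker_id [::] [:: P; X]).
  have cE : dcoev d ⊠ idm P === W [::] [::] [:: X; Y] (dcoev d) [:: P].
    by expand_whiskers; rewrite /= atens1a.
  apply: arr_inj; rewrite (arr_comp (braid_tensE s t) cE) Et -compA.
  rewrite (coev_transpose d duality_qp n) compA s'KY comp1m.
  rewrite -[X in arr X = _]compm1; apply: arr_comp; last exact/esym/arr_cast.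
  by expand_whiskers; rewrite /= atensa1.
exists (@CpqHom C V (cpq_tens (CpqOb Pt) (CpqOb Ps)) (cpq_one V) _ evP).
exists (@CpqHom C V (cpq_one V) (cpq_tens (CpqOb Ps) (CpqOb Pt)) _ coevP).
by apply: cpq_is_left_dual; exact: dualP.
Qed.

End Rigidity.

Theorem corollary4p4 (C : strict_monoidal) (V : pivotal_pair C) :
  (left_rigid C -> left_rigid (cpq V)) /\
  (right_rigid C -> right_rigid (cpq V)).
Proof.
split=> rigid A; have [n sn] := proj1 (braidP_inverse_mates _) (cpbP A).
  have [Y [e [c ec]]] := rigid (cpo A); pose d := Duality ec.
  have tk := proj1 (inverse_mates_transpose d _ _) sn.
  have Pt := proj2 (braidP_inverse_mates _) (ex_intro _ _ tk).
  by exists (CpqOb Pt); exact: (@cpq_left_dual _ V A (CpqOb Pt) d n (proj1 sn)).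
have [Y [e [c ec]]] := rigid (cpo A); pose d := Duality ec.
(* Here [A] lives on the left dual of [Y], so the triple over [Y] is the one
   whose transposes are the data of [A]. *)
pose t := cotranspose (duality_tens d (duality_pq V))
  (duality_tens (duality_pq V) d) n.
pose k := cotranspose (duality_tens d (duality_qp V))
  (duality_tens (duality_qp V) d) (cpb A).
have tk : inverse_mates t k.
  by apply/(inverse_mates_transpose d); rewrite !cotransposeK.
have Pt := proj2 (braidP_inverse_mates _) (ex_intro _ _ tk).
exists (CpqOb Pt); apply: (@cpq_left_dual _ V (CpqOb Pt) A d k (proj1 tk)).
by rewrite cotransposeK.
Qed.
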